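(* There exist $a>0$ and $u\in\mathscr S(\mathbb R)$ (the Schwartz space, complex-valued functions) such that $$\iint_{[0,a]^{2}}\mathcal W(u,u)(x,\xi)\,dx\,d\xi>\|u\|_{L^{2}(\mathbb R)}^{2},$$ where $\mathcal W(u,u)$ is the Wigner distribution of $u$.
   Context: For $u,v\in L^{2}(\mathbb R)$ the Wigner distribution is $$\mathcal W(u,v)(x,\xi)=\int_{\mathbb R}e^{-2i\pi z\xi}\,u\bigl(x+\tfrac z2\bigr)\,\overline{v\bigl(x-\tfrac z2\bigr)}\,dz .$$ $\mathcal W(u,u)$ is real-valued, and $\mathcal W(u,v)\in\mathscr S(\mathbb R^{2})$ for $u,v\in\mathscr S(\mathbb R)$. *)

(* Defs.v *)
From HB Require Import structures.
From mathcomp Require Import all_boot all_order all_algebra.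
From mathcomp Require Import complex.
From mathcomp Require Import all_classical all_reals all_analysis.

Set Implicit Arguments.
Unset Strict Implicit.
Unset Printing Implicit Defensive.

Import Order.TTheory GRing.Theory Num.Theory.
Import numFieldNormedType.Exports.

Local Open Scope classical_set_scope.
Local Open Scope ring_scope.
Local Open Scope complex_scope.

(* Rintegral and L2norm below go through fine, which is 0 at +oo and -oo; the
   values are the usual ones for integrable f and square-integrable u. *)
Definition cintegral (d : measure_display) (T : measurableType d)
    (R : realType) (mu : {measure set T -> \bar R}) (D : set T)
    (f : T -> R[i]) : R[i] :=
  Rintegral mu D (fun x => complex.Re (f x))
  +i* Rintegral mu D (fun x => complex.Im (f x)).

(* e^{it} for real t *)
Definition cexpi (R : realType) (t : R) : R[i] := cos t +i* sin t.

Definition wigner (R : realType) (u v : R -> R[i]) (x xi : R) : R[i] :=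
  cintegral lebesgue_measure setT
    (fun z => cexpi (- (2 * pi * z * xi)) * u (x + z / 2) * (v (x - z / 2))^*).

Definition csmooth (R : realType) (u : R -> R[i]) : Prop :=
  forall (n : nat) (x : R),
    derivable (derive1n n (fun t => complex.Re (u t))) x 1 /\
    derivable (derive1n n (fun t => complex.Im (u t))) x 1.

Definition cderive1n (R : realType) (n : nat) (u : R -> R[i]) (x : R) : R[i] :=
  derive1n n (fun t => complex.Re (u t)) x
  +i* derive1n n (fun t => complex.Im (u t)) x.

Definition schwartz (R : realType) (u : R -> R[i]) : Prop :=
  csmooth u /\
  forall k n : nat, exists M : R, forall x : R,
    `|x| ^+ k * Normc.normc (cderive1n n u x) <= M.

Definition L2norm (R : realType) (u : R -> R[i]) : R :=
  fine (Lnorm lebesgue_measure 2%:E (fun x => (Normc.normc (u x))%:E)).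

(* Main.v *)
(* The Wigner distribution of a coherent state centred at the phase-space point
   (T, T) is a Gaussian bump at (T, T), so up to an exponentially small error
   its whole mass lies in [0, 2T]^2.  Adding e times the opposite coherent
   state, centred at (-T, -T), costs e^2 in norm, but creates an interference
   term 2e exp(-2 pi (x^2 + xi^2)) cos(4 pi T (x - xi)) at the origin, a corner
   of the square.  The sharp cutoff there makes its integral decay only
   polynomially in T: it is at least of order e / T^2.  For e a small multiple
   of T^-2 the gain is of order T^-4 and beats the exponentially small loss. *)

Require Import Defs.
From HB Require Import structures.
From mathcomp Require Import all_boot all_order all_algebra.
From mathcomp Require Import complex ring lra.
From mathcomp Require Import all_classical all_reals all_analysis.
From mathcomp Require Import measurable_realfun.

Set Implicit Arguments.
Unset Strict Implicit.
Unset Printing Implicit Defensive.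

Import Order.TTheory GRing.Theory Num.Theory.
Import numFieldNormedType.Exports.

Local Open Scope classical_set_scope.
Local Open Scope ring_scope.
Local Open Scope complex_scope.

(** * Integrability of real-valued functions *)

Section integrable_EFin.
Context d (T : measurableType d) (R : realType).
Variables (mu : {measure set T -> \bar R}) (D : set T).
Hypothesis mD : measurable D.
Implicit Types f g : T -> R.

Lemma integrable_EFinD f g : mu.-integrable D (EFin \o f) ->
  mu.-integrable D (EFin \o g) ->
  mu.-integrable D (EFin \o (fun x => f x + g x)).
Proof. exact: integrableD. Qed.

Lemma integrable_EFinZl (k : R) f : mu.-integrable D (EFin \o f) ->
  mu.-integrable D (EFin \o (fun x => k * f x)).
Proof. exact: integrableZl. Qed.

Lemma integrable_EFin_patch f :
  mu.-integrable D (EFin \o f) <-> mu.-integrable setT (EFin \o (f \_ D)).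
Proof. by rewrite -restrict_EFin; exact: integrable_mkcond. Qed.

End integrable_EFin.

(** * Integrals of derivatives *)

Lemma continuous_is_derive (R : realType) (F f : R -> R) :
  (forall x : R, is_derive x 1 F (f x)) -> continuous F.
Proof.
move=> dF x; apply: differentiable_continuous.
by apply/derivable1_diffP; have [] := dF x.
Qed.

Lemma Rintegral_derive_itv (R : realType) (F f : R -> R) (a b : R) :
  a < b -> continuous f -> (forall x : R, is_derive x 1 F (f x)) ->
  \int[lebesgue_measure]_(x in `[a, b]) f x = F b - F a.
Proof.
move=> ab cf dF; rewrite /Rintegral (@continuous_FTC2 _ f F)//.
- exact: continuous_subspaceT.
- have cF := continuous_is_derive dF.
  split=> [x _||]; first by have [] := dF x.
    exact/cvg_at_right_filter/cF.
  exact/cvg_at_left_filter/cF.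
- by move=> x _; rewrite derive1E; have [_ ->] := dF x.
Qed.

Lemma continuous_integrable_itv (R : realType) (f : R -> R) (a b : R) :
  continuous f -> lebesgue_measure.-integrable `[a, b] (EFin \o f).
Proof.
move=> cf; apply: continuous_compact_integrable; first exact: segment_compact.
exact: continuous_subspaceT.
Qed.

(** Dominated convergence along growing symmetric intervals gives the full integral as a limit,
    while the fundamental theorem of calculus turns each term into a difference of boundary values
    of F, which tends to 0. *)
Lemma Rintegral_derive_vanish (R : realType) (F f : R -> R) :
  continuous f -> (forall x : R, is_derive x 1 F (f x)) ->
  lebesgue_measure.-integrable [set: R] (EFin \o f) ->
  F n%:R @[n --> \oo] --> 0 -> F (- n%:R) @[n --> \oo] --> 0 ->
  \int[lebesgue_measure]_x f x = 0.
Proof.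
move=> cf dF intf Fy FNy.
(* The successor keeps the interval nondegenerate at n = 0, as [Rintegral_derive_itv] requires;
   [cvg_shiftS] undoes the shift at the end. *)
pose A (n : nat) : set R := [set` `[- n.+1%:R, n.+1%:R]].
have limI : \int[lebesgue_measure]_(x in A n) f x @[n --> \oo] -->
    \int[lebesgue_measure]_x f x.
  apply: fine_cvg; rewrite /Rintegral fineK; last exact: integrable_fin_num.
  under eq_fun do rewrite integral_mkcond.
  apply: (@dominated_cvg _ _ _ lebesgue_measure _ measurableT
    (fun n => (EFin \o f) \_ (A n)) (EFin \o f) (abse \o (EFin \o f))).
  - move=> n; apply/(measurable_restrictT _ _).1 => //.
      exact: measurable_itv.
    apply/measurable_EFinP; apply: measurable_funTS.
    exact: continuous_measurable_fun.
  - move=> x _; apply: cvg_near_cst; exists (Num.trunc `|x|) => // n /= xn.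
    rewrite patchE ifT// inE /A/= in_itv/= -ler_norml ltW//.
    rewrite (lt_le_trans (truncnS_gt `|x|))// ler_nat//.
  - by [].
  - exact: integrable_abse intf.
  - move=> n x _; rewrite patchE; case: ifP => //= _.
    by rewrite normr0 lee_fin.
have limD : \int[lebesgue_measure]_(x in A n) f x @[n --> \oo] --> (0 : R).
  under eq_fun => n.
    rewrite (Rintegral_derive_itv _ cf dF); last first.
      by rewrite (@lt_trans _ _ 0)// ?oppr_lt0 ltr0n.
    over.
  rewrite -(subr0 0); apply: cvgB.
    by rewrite (cvg_shiftS (fun n => F n%:R)).
  by rewrite (cvg_shiftS (fun n => F (- n%:R))).
exact: cvg_unique limI limD.
Qed.

(** * Gaussian integrals *)

Definition gauss (R : realType) (b m x : R) : R := expR (- (b * (x - m) ^+ 2)).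

Section gauss.
Variables (R : realType) (b : R).
Hypothesis b_gt0 : 0 < b.
Implicit Types m x : R.
Notation mu := (@lebesgue_measure R).

Lemma gauss_gt0 m x : 0 < gauss b m x.
Proof. exact: expR_gt0. Qed.

Lemma is_derive_gauss m x :
  is_derive x 1 (gauss b m) (- (2 * b * (x - m)) * gauss b m x).
Proof.
rewrite /gauss; apply: is_derive_eq.
rewrite /GRing.scale/=; ring.
Qed.

Lemma continuous_gauss m : continuous (gauss b m).
Proof. exact: continuous_is_derive (is_derive_gauss m). Qed.

Lemma gauss_normal m x :
  gauss b m x = Num.sqrt (pi / b) * normal_pdf m (Num.sqrt (2 * b))^-1 x.
Proof.
have b0 : b != 0 by rewrite gt_eqF.
have b20 : 0 <= 2 * b by rewrite mulr_ge0// ltW.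
have s0 : (Num.sqrt (2 * b))^-1 != 0.
  by rewrite invr_eq0 gt_eqF// sqrtr_gt0 mulr_gt0.
rewrite normal_pdfE// /normal_peak /normal_fun /gauss exprVn sqr_sqrtr//.
have -> : (2 * b)^-1 * pi *+ 2 = pi / b by rewrite -mulr_natl; field.
rewrite mulVKf; last by rewrite gt_eqF// sqrtr_gt0 divr_gt0// pi_gt0.
by congr expR; rewrite -mulr_natl; field.
Qed.

Lemma integrable_gauss m : mu.-integrable setT (EFin \o gauss b m).
Proof.
have -> : EFin \o gauss b m = (fun x =>
    (Num.sqrt (pi / b))%:E * (normal_pdf m (Num.sqrt (2 * b))^-1 x)%:E)%E.
  by apply/funext => x; rewrite /= gauss_normal EFinM.
by apply: integrableZl => //; exact: integrable_normal_pdf.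
Qed.

Lemma Rintegral_gauss m : \int[mu]_x gauss b m x = Num.sqrt (pi / b).
Proof.
under eq_Rintegral do rewrite gauss_normal.
rewrite RintegralZl//; last exact: integrable_normal_pdf.
by rewrite /Rintegral integral_normal_pdf mulr1.
Qed.

End gauss.

Lemma le_gauss (R : realType) (b b' m x : R) : b' <= b -> gauss b m x <=
  gauss b' m x.
Proof. by move=> bb; rewrite ler_expR lerN2 ler_wpM2r// sqr_ge0. Qed.

(* Half of the decay of the Gaussian absorbs the linear factor. *)
Lemma norm_le_gauss (R : realType) (b m x : R) : 0 < b ->
  `|x - m| * gauss b m x <= (1 + 2 / b) * gauss (b / 2) m x.
Proof.
move=> b0; set y := x - m.
have -> : gauss b m x = gauss (b / 2) m x * gauss (b / 2) m x.
  by rewrite /gauss -expRD; congr expR; field.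
rewrite mulrA ler_wpM2r ?expR_ge0// -ler_pdivlMr ?expR_gt0//
  /gauss -expRN opprK.
have : 1 + b / 2 * y ^+ 2 <= expR (b / 2 * y ^+ 2) by exact: expR_ge1Dx.
have y1 : `|y| <= 1 + y ^+ 2.
  rewrite -real_normK ?num_real//; have := sqr_ge0 (`|y| - 1); nra.
move=> h; apply: (le_trans y1).
apply: (@le_trans _ _ ((1 + 2 / b) * (1 + b / 2 * y ^+ 2))).
  have -> : (1 + 2 / b) * (1 + b / 2 * y ^+ 2) = 
     1 + y ^+ 2 + (2 / b + b / 2 * y ^+ 2) by field; rewrite gt_eqF.
  rewrite lerDl; have := divr_gt0 (@ltr0n R 2) b0; have := sqr_ge0 y; nra.
by rewrite ler_wpM2l// addr_ge0// divr_ge0// ltW.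
Qed.


Lemma gauss_dominated_integrable (R : realType) (b m K : R) (f : R -> R) :
  0 < b -> continuous f -> (forall x, `|f x| <= K * gauss b m x) ->
  lebesgue_measure.-integrable [set: R] (EFin \o f).
Proof.
move=> b0 cf fK.
apply: (le_integrable measurableT _ _
  (integrableZl measurableT K (integrable_gauss b0 m))).
  by apply/measurable_EFinP; exact: continuous_measurable_fun.
by move=> x _; rewrite /= lee_fin (le_trans (fK x))// ler_norm.
Qed.

Lemma cvg_gauss_nat (R : realType) (b m : R) : 0 < b ->
  gauss b m n%:R @[n --> \oo] --> 0.
Proof.
move=> b0.
have gE x : gauss b m x = gauss_fun ((x - m) * Num.sqrt b).
  by rewrite /gauss /gauss_fun exprMn sqr_sqrtr ?ltW// mulrC.
apply: (cvg_comp _ (gauss b m) (@cvgr_idn R)).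
rewrite (_ : gauss b m = fun x => gauss_fun ((x - m) * Num.sqrt b));
  last exact/funext.
apply: (cvg_comp (fun x => (x - m) * Num.sqrt b) _ _ (@cvg_gauss_fun R)).
by apply: gt0_cvgMly; [rewrite sqrtr_gt0|exact: cvg_addrr].
Qed.

Lemma cvg_gauss_natN (R : realType) (b m : R) : 0 < b ->
  gauss b m (- n%:R) @[n --> \oo] --> 0.
Proof.
move=> b0.
have gE x : gauss b m (- x) = gauss b (- m) x.
  by congr expR; rewrite opprK -opprD sqrrN.
by under eq_fun do rewrite gE; exact: cvg_gauss_nat.
Qed.

Lemma gauss_dominated_Rintegral_derive (R : realType) (b m K : R)
    (F f : R -> R) : 0 < b -> continuous f ->
  (forall x : R, is_derive x 1 F (f x)) ->
  lebesgue_measure.-integrable [set: R] (EFin \o f) ->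
  (forall x, `|F x| <= K * gauss b m x) ->
  \int[lebesgue_measure]_x f x = 0.
Proof.
move=> b0 cf dF intf FK.
have cvgF (s : R^nat) : gauss b m (s n) @[n --> \oo] --> 0 ->
    F (s n) @[n --> \oo] --> 0.
  move=> cs; apply: norm_cvg0.
  apply: (@squeeze_cvgr _ _ _ _ (cst 0) (fun n => K * gauss b m (s n))).
  - by apply: nearW => n; rewrite normr_ge0 FK.
  - exact: cvg_cst.
  - by rewrite -[0](mulr0 K); apply: cvgM => //; exact: cvg_cst.
apply: Rintegral_derive_vanish cf dF intf _ _; apply: cvgF.
  exact: cvg_gauss_nat.
exact: cvg_gauss_natN.
Qed.

(** * The Fourier transform of a Gaussian *)

Section gauss_fourier.
Variables (R : realType) (b : R).
Hypothesis b_gt0 : 0 < b.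
Implicit Types m t w x : R.
Notation mu := (@lebesgue_measure R).

Lemma is_derive_cos_affine w t x :
  is_derive x 1 (fun x => cos (w * x + t)) (- w * sin (w * x + t)).
Proof. by apply: is_derive_eq; rewrite /GRing.scale/=; ring. Qed.

Lemma norm_cos_le1 x : `|cos x| <= 1.
Proof. by rewrite ler_norml cos_geN1 cos_le1. Qed.

Lemma norm_sin_le1 x : `|sin x| <= 1.
Proof. by rewrite ler_norml sin_geN1 sin_le1. Qed.

Lemma continuous_gauss_cos m w t :
  continuous (fun x => gauss b m x * cos (w * x + t)).
Proof.
move=> x; apply: cvgM; first exact: continuous_gauss.
exact: continuous_is_derive (is_derive_cos_affine w t) x.
Qed.

Lemma norm_gauss_cos m x y : `|gauss b m x * cos y| <= gauss b m x.
Proof.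
by rewrite normrM gtr0_norm ?gauss_gt0// ler_piMr ?norm_cos_le1// ltW//
  gauss_gt0.
Qed.

Lemma integrable_gauss_cos m w t :
  mu.-integrable setT (EFin \o (fun x => gauss b m x * cos (w * x + t))).
Proof.
apply: (@gauss_dominated_integrable _ b m 1) => //.
  exact: continuous_gauss_cos.
by move=> x; rewrite mul1r norm_gauss_cos.
Qed.

(* The w-derivative of exp(w^2/4b) exp(-b(x-m)^2) cos(w(x-m)+t) is the
   x-derivative of [fourier_prim], so its integral over the line vanishes. *)
Let k m t w x := expR (w ^+ 2 / (4 * b)) * gauss b m x * cos (w * (x - m) + t).
Let fourier_prim m t w x :=
  expR (w ^+ 2 / (4 * b)) * gauss b m x * sin (w * (x - m) + t) / (2 * b).
Let dk m t w x := expR (w ^+ 2 / (4 * b)) *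
  (w / (2 * b) * (gauss b m x * cos (w * (x - m) + t)) -
  (x - m) * gauss b m x * sin (w * (x - m) + t)).

Let is_derive_k m t w x : is_derive w 1 (fun w => k m t w x) (dk m t w x).
Proof.
rewrite /k /dk; apply: is_derive_eq; rewrite /GRing.scale/=.
by field; rewrite gt_eqF.
Qed.

Let is_derive_prim m t w x :
  is_derive x 1 (fourier_prim m t w) (dk m t w x).
Proof.
rewrite /fourier_prim /dk /gauss; apply: is_derive_eq; rewrite /GRing.scale/=.
by field; rewrite gt_eqF.
Qed.

Let continuous_k m t w : continuous (k m t w).
Proof.
(* The function supplied is the x-derivative of [k]: having a derivative everywhere implies
   continuity. The same device serves for [dk]. *)
apply: (@continuous_is_derive _ _ (fun x => expR (w ^+ 2 / (4 * b)) *
  (- (2 * b * (x - m)) * gauss b m x * cos (w * (x - m) + t)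
   - w * gauss b m x * sin (w * (x - m) + t)))) => x.
rewrite /k /gauss; apply: is_derive_eq; rewrite /GRing.scale/=.
by ring.
Qed.

Let continuous_dk m t w : continuous (dk m t w).
Proof.
apply: (@continuous_is_derive _ _ (fun x => expR (w ^+ 2 / (4 * b)) *
  (w / (2 * b) * (- (2 * b * (x - m)) * gauss b m x * cos (w * (x - m) + t)
   - w * gauss b m x * sin (w * (x - m) + t)) -
  (gauss b m x * sin (w * (x - m) + t) -
   2 * b * (x - m) ^+ 2 * gauss b m x * sin (w * (x - m) + t)
   + (x - m) * gauss b m x * w * cos (w * (x - m) + t))))) => x.
rewrite /dk /gauss; apply: is_derive_eq; rewrite /GRing.scale/=.
by field; rewrite gt_eqF.
Qed.

(** The bound is uniform over |w| <= r, as domination requires. The factor x - m in [dk] costs half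
    of the decay rate. *)
Let norm_dk m t (r : R) w x : `|w| <= r ->
  `|dk m t w x| <= expR (r ^+ 2 / (4 * b)) * (r / (2 * b) + (1 + 2 / b)) *
    gauss (b / 2) m x.
Proof.
move=> wr; have r0 : 0 <= r by rewrite (le_trans _ wr).
have wr2 : w ^+ 2 <= r ^+ 2.
  by rewrite -[w ^+ 2]real_normK ?num_real// ler_pXn2r// nnegrE.
rewrite /dk normrM ger0_norm ?expR_ge0// -[leRHS]mulrA.
apply: ler_pM; [exact: expR_ge0|exact: normr_ge0| |].
  by rewrite ler_expR ler_wpM2r// invr_ge0 mulr_ge0// ltW.
apply: (le_trans (ler_normB _ _)); rewrite [leRHS]mulrDl lerD//.
  rewrite normrM ler_pM// ?(le_trans (norm_gauss_cos _ _ _))//.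
    by rewrite normrM normfV [`|2 * b|]gtr0_norm ?mulr_gt0// ler_wpM2r//
      invr_ge0 mulr_ge0// ltW.
  by rewrite le_gauss// ler_pdivrMr// ler_peMr ?ler1n// ltW.
rewrite normrM (le_trans _ (norm_le_gauss m x b_gt0))//.
by rewrite normrM (gtr0_norm (gauss_gt0 _ _ _)) ler_piMr ?norm_sin_le1//
  mulr_ge0// ltW// gauss_gt0.
Qed.

Let b2_gt0 : 0 < b / 2. Proof. by rewrite divr_gt0. Qed.

Let integrable_dk m t w : mu.-integrable setT (EFin \o dk m t w).
Proof.
apply: (gauss_dominated_integrable b2_gt0) => //.
by move=> x; exact: (norm_dk m t x (lexx _)).
Qed.

Let norm_k m t w x : `|k m t w x| <= expR (w ^+ 2 / (4 * b)) * gauss b m x.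
Proof.
rewrite /k -mulrA normrM ger0_norm ?expR_ge0// ler_wpM2l ?expR_ge0//.
exact: norm_gauss_cos.
Qed.

Let integrable_k m t w : mu.-integrable setT (EFin \o k m t w).
Proof.
by apply: (gauss_dominated_integrable b_gt0) => // x; exact: norm_k.
Qed.

Let Rintegral_dk m t w : \int[mu]_x dk m t w x = 0.
Proof.
apply: (@gauss_dominated_Rintegral_derive _ b m
  (expR (w ^+ 2 / (4 * b)) / (2 * b)) (fourier_prim m t w)) => // x.
rewrite /fourier_prim mulrAC normrM ger0_norm; last first.
  by rewrite !mulr_ge0 ?invr_ge0 ?mulr_ge0 ?expR_ge0// ltW.
rewrite [X in X * _]mulrAC ler_piMr ?norm_sin_le1//.
by rewrite !mulr_ge0 ?invr_ge0 ?mulr_ge0 ?expR_ge0// ltW.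
Qed.

(** Differentiation under the integral sign on the unit neighbourhood of w: every v there has |v| <=
    |w| + 1, so [norm_dk] provides one integrable dominating function, and the integral of [dk] is
    0. *)
Let is_derive_Rintegral_k m t w :
  is_derive w 1 (fun w => \int[mu]_x k m t w x) 0.
Proof.
have wI : w \in `](w - 1), (w + 1)[ by rewrite in_itv/= ltrBlDr ltrDl ltr01.
pose r := `|w| + 1.
pose K := expR (r ^+ 2 / (4 * b)) * (r / (2 * b) + (1 + 2 / b)).
pose G x := K * gauss (b / 2) m x.
have K0 : 0 <= K.
  by rewrite mulr_ge0 ?expR_ge0// !addr_ge0// ?divr_ge0 ?mulr_ge0// ?addr_ge0//
    ltW.
have G0 x : 0 <= G x by rewrite mulr_ge0// ltW// gauss_gt0.
have intG : mu.-integrable setT (EFin \o G).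
  apply: (gauss_dominated_integrable b2_gt0 (K := K) (m := m)).
    by move=> x; apply: cvgM; [exact: cvg_cst|exact: continuous_gauss].
  by move=> x; rewrite ger0_norm.
have d1k v x : partial1of2 (k m t) v x = dk m t v x.
  by rewrite partial1of2E; have [_ ->] := is_derive_k m t v x.
have GU v x : `]w - 1, w + 1[%classic v -> setT x ->
  `|partial1of2 (k m t) v x| <= G x.
  rewrite /= in_itv/= => /andP[v1 v2] _; rewrite d1k; apply: norm_dk.
  by rewrite /r; have := ler_norm w; have := ler_norm (- w);
    rewrite normrN ler_norml; lra.
have dkv v x : `]w - 1, w + 1[%classic v -> setT x ->
  derivable (k m t ^~ x) v 1.
  by move=> _ _; have [] := is_derive_k m t v x.
have intk v : `]w - 1, w + 1[%classic v -> mu.-integrable setT (EFin \o k m t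
  v).
  by move=> _; exact: integrable_k.
apply: DeriveDef.
  exact: (derivable_under_integral measurableT wI intk dkv G0 intG GU).
rewrite -derive1E (differentiation_under_integral measurableT wI intk dkv G0
  intG GU).
by under eq_Rintegral do rewrite d1k; rewrite Rintegral_dk.
Qed.

Lemma Rintegral_gauss_cos m w t :
  \int[mu]_x (gauss b m x * cos (w * x + t)) =
  Num.sqrt (pi / b) * expR (- (w ^+ 2 / (4 * b))) * cos (w * m + t).
Proof.
have kE v s : \int[mu]_x k m s v x =
    expR (v ^+ 2 / (4 * b)) * \int[mu]_x (gauss b m x * cos (v * x +
      (s - v * m))).
  rewrite -RintegralZl//; last exact: integrable_gauss_cos.
  apply: eq_Rintegral => x _; rewrite /k -mulrA; congr (_ * (_ * cos _)); ring.
(* With the phase frozen at w m + t, the integral of [k] takes the same value at frequency w, where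
   the cosine is cos(wx + t), and at frequency 0, where the cosine is constant. *)
have := is_derive_0_is_cst w 0 (is_derive_Rintegral_k m (w * m + t)).
rewrite !kE.
rewrite [in RHS]expr0n mul0r expR0 mul1r.
under [in RHS]eq_Rintegral do rewrite !mul0r add0r subr0.
rewrite RintegralZr//; last exact: integrable_gauss.
rewrite Rintegral_gauss// addrAC subrr add0r => h.
by rewrite mulrAC -h mulrAC -expRD subrr expR0 mul1r.
Qed.
End gauss_fourier.

(** * Schwartz functions *)

(* For fixed b, m, w these functions are closed under differentiation. *)
Definition gauss_trig (R : realType) (b m w : R) (p q : {poly R}) (x : R) : R :=
  gauss b m x * (p.[x] * cos (w * x) + q.[x] * sin (w * x)).

Section gauss_trig.
Variables (R : realType) (b w : R).
Hypothesis b_gt0 : 0 < b.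
Implicit Types (m x : R) (p q : {poly R}).

Lemma is_derive_gauss_trig m p q x :
  let l := (- (2 * b))%:P * ('X - m%:P) in
  is_derive x 1 (gauss_trig b m w p q)
    (gauss_trig b m w (l * p + p^`() + w%:P * q) (l * q + q^`() - w%:P * p) x).
Proof.
move=> l; rewrite /gauss_trig /gauss; apply: is_derive_eq.
rewrite /l !hornerE /GRing.scale/=; ring.
Qed.

(** Since |x| <= exp|x - m| exp|m|, it suffices to bound n y - b y^2 for y = |x - m|; completing the
    square gives the maximum n^2 / (4b). *)
Lemma expn_gauss_bounded m (n : nat) :
  exists2 M : R, 0 <= M & forall x, `|x| ^+ n * gauss b m x <= M.
Proof.
exists (expR (n%:R * `|m| + n%:R ^+ 2 / (4 * b))); first exact: expR_ge0.
move=> x.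
have h : `|x| <= expR `|x - m| * expR `|m|.
  rewrite -expRD (le_trans _ (expR_ge1Dx _))// -[x in `|x|](subrK m).
  by rewrite (le_trans (ler_normD _ _))// lerDr.
apply: (@le_trans _ _ ((expR `|x - m| * expR `|m|) ^+ n * gauss b m x)).
  by rewrite ler_wpM2r ?expR_ge0// lerXn2r// nnegrE// mulr_ge0 ?expR_ge0.
rewrite -expRD -expRM_natl /gauss -expRD ler_expR mulrDr.
rewrite -[(x - m) ^+ 2]real_normK ?num_real//.
set y := `|x - m|; rewrite -subr_ge0.
rewrite [leRHS](_ : _ = b * (y - n%:R / (2 * b)) ^+ 2); last first.
  by field; rewrite gt_eqF.
by rewrite mulr_ge0 ?sqr_ge0// ltW.
Qed.

Lemma poly_gauss_bounded m p (n : nat) :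
  exists2 M : R, 0 <= M & forall x, `|x| ^+ n * (gauss b m x * `|p.[x]|) <= M.
Proof.
elim/poly_ind: p n => [|p c IH] n.
  by exists 0 => // x; rewrite horner0 normr0 !mulr0.
have [M1 M10 h1] := IH n.+1; have [M2 M20 h2] := expn_gauss_bounded m n.
exists (M1 + M2 * `|c|) => [|x]; first by rewrite addr_ge0// mulr_ge0.
rewrite hornerMXaddC.
apply: (@le_trans _ _ (`|x| ^+ n * (gauss b m x * (`|p.[x] * x| + `|c|)))).
  by rewrite ler_wpM2l ?exprn_ge0// ler_wpM2l ?expR_ge0// ler_normD.
rewrite normrM !mulrDr lerD//; last by rewrite mulrA ler_wpM2r.
by rewrite (le_trans _ (h1 x))// exprS le_eqVlt; apply/orP; left; apply/eqP;
  ring.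
Qed.

Lemma gauss_trig_bounded m p q (n : nat) :
  exists M : R, forall x, `|x| ^+ n * `|gauss_trig b m w p q x| <= M.
Proof.
have [M1 M10 h1] := poly_gauss_bounded m p n.
have [M2 M20 h2] := poly_gauss_bounded m q n.
exists (M1 + M2) => x; apply: (le_trans _ (lerD (h1 x) (h2 x))).
rewrite -!mulrDr /gauss_trig normrM gtr0_norm ?gauss_gt0//.
rewrite ler_wpM2l ?exprn_ge0// ler_wpM2l ?expR_ge0//.
rewrite (le_trans (ler_normD _ _))// !normrM lerD// ler_piMr//.
  exact: norm_cos_le1.
exact: norm_sin_le1.
Qed.

(** A sum is needed because the real and imaginary parts of the cat state each combine Gaussians
    with two different centres. *)
Lemma derive1n_gauss_trig m m' p q p' q' (n : nat) :
  exists p1 q1 p1' q1', derive1n n (gauss_trig b m w p q \+ gauss_trig b m' w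
    p' q')
    = gauss_trig b m w p1 q1 \+ gauss_trig b m' w p1' q1'.
Proof.
elim: n => [|n [p1 [q1 [p1' [q1' IH]]]]]; first by exists p, q, p', q'.
do 4 eexists; rewrite derive1nS IH; apply/funext => x; rewrite derive1E /=.
have d1 := is_derive_gauss_trig m p1 q1 x.
have d2 := is_derive_gauss_trig m' p1' q1' x.
by have [_ ->] := is_deriveD d1 d2.
Qed.

Lemma derivable_gauss_trig m m' p q p' q' x :
  derivable (gauss_trig b m w p q \+ gauss_trig b m' w p' q') x 1.
Proof.
have d1 := is_derive_gauss_trig m p q x.
have d2 := is_derive_gauss_trig m' p' q' x.
by have [] := is_deriveD d1 d2.
Qed.

End gauss_trig.

Lemma normc_le (R : rcfType) (z : R[i]) :
  Normc.normc z <= `|complex.Re z| + `|complex.Im z|.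
Proof.
case: z => x y /=; rewrite -(@ler_pXn2r _ 2)// ?nnegrE ?sqrtr_ge0 ?addr_ge0//.
rewrite sqr_sqrtr ?addr_ge0 ?sqr_ge0// sqrrD !real_normK ?num_real//.
by rewrite addrAC lerDl mulrn_wge0// mulr_ge0.
Qed.

Lemma schwartz_gauss_trig (R : realType) (b w : R) (u : R -> R[i])
    (m m' n n' : R) (p q p' q' r s r' s' : {poly R}) : 0 < b ->
  (fun x => complex.Re (u x)) = gauss_trig b m w p q \+ gauss_trig b m' w p' q'
    ->
  (fun x => complex.Im (u x)) = gauss_trig b n w r s \+ gauss_trig b n' w r' s'
    ->
  schwartz u.
Proof.
move=> b0 ReE ImE; split=> [k x|k l].
  rewrite ReE ImE.
  have [p1 [q1 [p1' [q1' ->]]]] := derive1n_gauss_trig b w m m' p q p' q' k.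
  have [r1 [s1 [r1' [s1' ->]]]] := derive1n_gauss_trig b w n n' r s r' s' k.
  by split; exact: derivable_gauss_trig.
rewrite /cderive1n ReE ImE.
have [p1 [q1 [p1' [q1' ->]]]] := derive1n_gauss_trig b w m m' p q p' q' l.
have [r1 [s1 [r1' [s1' ->]]]] := derive1n_gauss_trig b w n n' r s r' s' l.
have [M1 h1] := gauss_trig_bounded w b0 m p1 q1 k.
have [M2 h2] := gauss_trig_bounded w b0 m' p1' q1' k.
have [M3 h3] := gauss_trig_bounded w b0 n r1 s1 k.
have [M4 h4] := gauss_trig_bounded w b0 n' r1' s1' k.
exists (M1 + M2 + (M3 + M4)) => x.
apply: (le_trans _ (lerD (lerD (h1 x) (h2 x)) (lerD (h3 x) (h4 x)))).
rewrite -!mulrDr ler_wpM2l ?exprn_ge0//.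
by rewrite (le_trans (normc_le _))//= lerD// ler_normD.
Qed.

(** * Product integrals and the L2 norm *)

Section Rintegral_prod.
Context d1 d2 (T1 : measurableType d1) (T2 : measurableType d2) (R : realType).
Variables (m1 : {sigma_finite_measure set T1 -> \bar R})
  (m2 : {sigma_finite_measure set T2 -> \bar R}).
Local Open Scope ereal_scope.

Let integrable_prodT (f : T1 -> R) (g : T2 -> R) :
  m1.-integrable setT (EFin \o f) -> m2.-integrable setT (EFin \o g) ->
  (m1 \x m2).-integrable setT (fun p => (f p.1 * g p.2)%:E).
Proof.
move=> intf intg.
have /measurable_EFinP mf := measurable_int _ intf.
have /measurable_EFinP mg := measurable_int _ intg.
apply/integrable12ltyP.
  apply/measurable_EFinP; apply: measurable_funM.
    exact: measurableT_comp mf _.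
  exact: measurableT_comp mg _.
under eq_integral => x _.
  under eq_integral => y _ do rewrite /= normrM EFinM.
  rewrite ge0_integralZl//; last first.
    by apply/measurable_EFinP; exact: measurableT_comp.
  over.
have /integrableP[_ fy] := intf; have /integrableP[_ gy] := intg.
rewrite ge0_integralZr//; last 2 first.
- by apply/measurable_EFinP; exact: measurableT_comp.
- exact: integral_ge0.
by rewrite lte_mul_pinfty ?integral_ge0// ge0_fin_numE ?integral_ge0.
Qed.

Let integral_prodT (f : T1 -> R) (g : T2 -> R) :
  m1.-integrable setT (EFin \o f) -> m2.-integrable setT (EFin \o g) ->
  \int[m1 \x m2]_p (f p.1 * g p.2)%:E =
  \int[m1]_x (f x)%:E * \int[m2]_y (g y)%:E.
Proof.
move=> intf intg; rewrite -integral12_prod_meas1; last exact: integrable_prodT.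
transitivity (\int[m1]_x ((f x)%:E * \int[m2]_y (g y)%:E)).
  by apply: eq_integral => x _; rewrite /fubini_F/= -integralZl.
by rewrite -[\int[m2]_y _]fineK ?integrable_fin_num// integralZr.
Qed.

(** Extension by zero respects tensor products, so integrals over rectangles reduce to integrals
    over the whole product space. *)
Let patch_prod (A : set T1) (B : set T2) (f : T1 -> R) (g : T2 -> R) :
  (fun p => f p.1 * g p.2)%R \_ (A `*` B) =
  (fun p => (f \_ A) p.1 * (g \_ B) p.2)%R.
Proof.
apply/funext => -[x y]; rewrite !patchE/= in_setX/=.
by case: ifPn => [/andP[-> ->]//|]; rewrite negb_and => /orP[]/negbTE ->;
  rewrite ?mul0r ?mulr0.
Qed.

Lemma integrable_prod (A : set T1) (B : set T2) (f : T1 -> R) (g : T2 -> R) :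
  measurable A -> measurable B ->
  m1.-integrable A (EFin \o f) -> m2.-integrable B (EFin \o g) ->
  (m1 \x m2).-integrable (A `*` B) (EFin \o (fun p => f p.1 * g p.2)%R).
Proof.
move=> mA mB /(integrable_EFin_patch _ mA) intf /(integrable_EFin_patch _ mB)
  intg.
apply/integrable_EFin_patch; first exact: measurableX.
by rewrite patch_prod; exact: integrable_prodT.
Qed.

Lemma Rintegral_prod (A : set T1) (B : set T2) (f : T1 -> R) (g : T2 -> R) :
  measurable A -> measurable B ->
  m1.-integrable A (EFin \o f) -> m2.-integrable B (EFin \o g) ->
  (\int[m1 \x m2]_(p in A `*` B) (f p.1 * g p.2) =
  \int[m1]_(x in A) f x * \int[m2]_(y in B) g y)%R.
Proof.
move=> mA mB /(integrable_EFin_patch _ mA) intf /(integrable_EFin_patch _ mB)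
  intg.
rewrite [LHS]Rintegral_mkcond [X in (X * _)%R]Rintegral_mkcond.
rewrite [X in (_ * X)%R]Rintegral_mkcond patch_prod /Rintegral integral_prodT//.
by rewrite fineM ?integrable_fin_num.
Qed.

End Rintegral_prod.

Lemma L2norm_sqr (R : realType) (u : R -> R[i]) :
  lebesgue_measure.-integrable setT
    (EFin \o (fun x => Normc.normc (u x) ^+ 2)) ->
  L2norm u ^+ 2 = \int[lebesgue_measure]_x Normc.normc (u x) ^+ 2.
Proof.
move=> intu; rewrite /L2norm.
set N := Lnorm _ _ _.
have N0 : (0 <= N)%E by exact: Lnorm_ge0.
have NE : (N `^ 2 = \int[lebesgue_measure]_x (Normc.normc (u x) ^+ 2)%:E)%E.
  rewrite /N powR_Lnorm//; apply: eq_integral => x _.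
  rewrite (_ : `|_|%E = `|Normc.normc (u x)|%:E)// poweR_EFin powR_mulrn//.
  by rewrite real_normK ?num_real.
(* An infinite norm would have an infinite square, contradicting integrability; without this, [fine]
   could replace +oo by 0. *)
have Nfin : N \is a fin_num.
  have := integrable_fin_num measurableT intu; rewrite /comp -NE.
  by case: N N0 {NE} => // _; rewrite poweRyr ?pnatr_eq0.
by rewrite /Rintegral -NE -[in RHS](fineK Nfin) poweR_EFin/= powR_mulrn//
  fine_ge0.
Qed.

(** * Gaussian integrals on an interval *)

Section gauss_itv.
Variables (R : realType) (b : R).
Hypothesis b_gt0 : 0 < b.
Notation mu := (@lebesgue_measure R).

(** The minorant [h] subtracts D times the Gaussians centred at the two endpoints, and its integral
    over the line is explicit. Inside the interval it lies below the Gaussian. Outside it is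
    nonpositive: for x < 0, (x - r)^2 >= r^2 + x^2, and symmetrically beyond 2r. *)
Lemma Rintegral_gauss_itv_ge (r : R) : 0 <= r ->
  Num.sqrt (pi / b) * (1 - 2 * gauss b 0 r) <=
  \int[mu]_(x in `[0, r + r]) gauss b r x.
Proof.
move=> r0; set D := gauss b 0 r.
have D0 : 0 <= D by rewrite ltW ?gauss_gt0.
have g0 m x : 0 <= gauss b m x by rewrite ltW ?gauss_gt0.
pose h (x : R) : R := gauss b r x + - D * (gauss b 0 x + gauss b (r + r) x).
have intD : mu.-integrable setT
    (EFin \o (fun x => - D * (gauss b 0 x + gauss b (r + r) x))).
  apply: integrable_EFinZl => //.
  by apply: integrable_EFinD => //; exact: integrable_gauss.
have inth : mu.-integrable setT (EFin \o h).
  by apply: integrable_EFinD => //; exact: integrable_gauss.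
have -> : Num.sqrt (pi / b) * (1 - 2 * D) = \int[mu]_x h x.
  rewrite /h RintegralD//; last exact: integrable_gauss.
  rewrite RintegralZl//; last first.
    by apply: integrable_EFinD => //; exact: integrable_gauss.
  rewrite RintegralD//; try exact: integrable_gauss.
  rewrite !Rintegral_gauss//; ring.
rewrite [leRHS]Rintegral_mkcond; apply: le_Rintegral => //.
  apply: (@integrable_EFin_patch _ _ R mu _ (measurable_itv `[0, r + r])
    (gauss b r)).1.
  by apply: continuous_integrable_itv; exact: continuous_gauss.
move=> x _; rewrite patchE /h; case: ifPn => [_|].
  by rewrite gerDl mulNr oppr_le0 mulr_ge0// addr_ge0.
have DM m : D * gauss b m x = expR (- (b * (r ^+ 2 + (x - m) ^+ 2))).
  by rewrite /D /gauss -expRD subr0; congr expR; ring.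
rewrite notin_setE/= in_itv/= => /negP; rewrite negb_and -!ltNge mulrDr !mulNr.
(* Outside its domain the restricted function takes the default value [point], which is 0 in R. *)
rewrite (_ : point = 0)//.
have D1 : 0 <= D * gauss b 0 x by exact: mulr_ge0.
have D2 : 0 <= D * gauss b (r + r) x by exact: mulr_ge0.
case/orP => hx.
  suff : gauss b r x <= D * gauss b 0 x by lra.
  by rewrite DM /gauss ler_expR lerN2 ler_wpM2l ?(ltW b_gt0)//; nra.
suff : gauss b r x <= D * gauss b (r + r) x by lra.
by rewrite DM /gauss ler_expR lerN2 ler_wpM2l ?(ltW b_gt0)//; nra.
Qed.

Lemma continuous_gauss_sin m w :
  continuous (fun x => gauss b m x * sin (w * x)).
Proof.
apply: (@continuous_is_derive _ _ (fun x =>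
  gauss b m x * (w * cos (w * x) - 2 * b * (x - m) * sin (w * x)))) => x.
by rewrite /gauss; apply: is_derive_eq; rewrite /GRing.scale/=; ring.
Qed.

(* Two integrations by parts: with g the Gaussian, the integrand exceeds the
   derivative of -g cos(wx)/w + 2bxg (1 - sin(wx))/w^2 minus 4bg/w^2; the choice
   of 1 - sin makes the second term nonnegative at a. *)
Lemma Rintegral_gauss_sin_ge (a w : R) : 0 < a -> 0 < w ->
  (1 - gauss b 0 a) / w - 4 * b / w ^+ 2 * Num.sqrt (pi / b) <=
  \int[mu]_(x in `[0, a]) (gauss b 0 x * sin (w * x)).
Proof.
move=> a0 w0.
pose F (x : R) : R := - (gauss b 0 x * cos (w * x)) / w +
  2 * b * x * gauss b 0 x * (1 - sin (w * x)) / w ^+ 2.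
pose f (x : R) : R := gauss b 0 x * sin (w * x) -
  gauss b 0 x * (4 * b ^+ 2 * x ^+ 2 - 2 * b) * (1 - sin (w * x)) / w ^+ 2.
have dF (x : R) : is_derive x 1 F (f x).
  rewrite /F /f /gauss; apply: is_derive_eq; rewrite /GRing.scale/=.
  by field; rewrite gt_eqF.
have cf : continuous f.
  pose f' (x : R) : R := -2 * b * x * gauss b 0 x * sin (w * x) +
    gauss b 0 x * (w * cos (w * x)) -
    (-2 * b * x * gauss b 0 x * (4 * b ^+ 2 * x ^+ 2 - 2 * b) * (1 - sin (w *
      x)) / w ^+ 2 +
     gauss b 0 x * (8 * b ^+ 2 * x) * (1 - sin (w * x)) / w ^+ 2 -
     gauss b 0 x * (4 * b ^+ 2 * x ^+ 2 - 2 * b) * (w * cos (w * x)) / w ^+ 2).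
  apply: (@continuous_is_derive _ _ f') => x.
  rewrite /f /f' /gauss; apply: is_derive_eq; rewrite /GRing.scale/=.
  by field; rewrite gt_eqF.
have intg : mu.-integrable `[0, a] (EFin \o gauss b 0).
  by apply: continuous_integrable_itv; exact: continuous_gauss.
have ints : mu.-integrable `[0, a] (EFin \o (fun x =>
  gauss b 0 x * sin (w * x))).
  by apply: continuous_integrable_itv; exact: continuous_gauss_sin.
have intK : mu.-integrable `[0, a] (EFin \o (fun x =>
  4 * b / w ^+ 2 * gauss b 0 x)).
  exact: integrable_EFinZl.
have gle : \int[mu]_(x in `[0, a]) gauss b 0 x <= Num.sqrt (pi / b).
  rewrite -(Rintegral_gauss b_gt0 0) [leLHS]Rintegral_mkcond;
    apply: le_Rintegral => //.
  - exact: (@integrable_EFin_patch _ _ R mu _ (measurable_itv `[0, a])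
      (gauss b 0)).1.
  - exact: integrable_gauss.
  - by move=> x _; rewrite patchE; case: ifP => // _; rewrite ltW// gauss_gt0.
have : \int[mu]_(x in `[0, a]) f x <=
    \int[mu]_(x in `[0, a]) (gauss b 0 x * sin (w * x) +
      4 * b / w ^+ 2 * gauss b 0 x).
  apply: le_Rintegral => //.
  - exact: continuous_integrable_itv.
  - exact: integrable_EFinD.
  - move=> x _; rewrite /f lerD2l.
    have -> : - (gauss b 0 x * (4 * b ^+ 2 * x ^+ 2 - 2 * b) * (1 - sin (w *
      x)) / w ^+ 2) =
      gauss b 0 x / w ^+ 2 * ((2 * b - 4 * b ^+ 2 * x ^+ 2) * (1 - sin (w *
        x))).
      by ring.
    have -> : 4 * b / w ^+ 2 * gauss b 0 x = gauss b 0 x / w ^+ 2 * (4 * b) by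
      ring.
    rewrite ler_wpM2l ?divr_ge0 ?sqr_ge0 ?(ltW (gauss_gt0 _ _ _))//.
    have := sin_geN1 (w * x); have := sin_le1 (w * x); set s := sin _ => s1 s2.
    (* The difference is a combination of 1 + s and 1 - s with nonnegative coefficients, and |s| <=
       1. *)
    rewrite -subr_ge0 [leRHS](_ : _ =
      2 * (b * (1 + s)) + 4 * ((b * x) ^+ 2 * (1 - s))); last by ring.
    have s3 : 0 <= 1 + s by lra.
    have s4 : 0 <= 1 - s by lra.
    apply: addr_ge0; apply: mulr_ge0 => //; apply: mulr_ge0 => //.
      exact: ltW.
    exact: sqr_ge0.
rewrite (Rintegral_derive_itv a0 cf dF) RintegralD// RintegralZl//.
have FE : (1 - gauss b 0 a) / w <= F a - F 0.
  rewrite /F !mulr0 mul0r cos0 sin0 mulr1 [gauss b 0 0]/gauss subrr expr0n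
    mulr0 oppr0 expR0.
  have h1 : 0 <= 2 * b * a * gauss b 0 a * (1 - sin (w * a)) / w ^+ 2.
    by rewrite !mulr_ge0 ?invr_ge0 ?sqr_ge0 ?subr_ge0 ?sin_le1 ?ltW ?gauss_gt0.
  have h2 : (1 - gauss b 0 a * cos (w * a)) / w >= (1 - gauss b 0 a) / w.
    rewrite ler_wpM2r ?invr_ge0 ?(ltW w0)// lerD2l lerN2 ler_piMr ?cos_le1//.
    by rewrite ltW// gauss_gt0.
  by move: h1 h2; rewrite !mulrDl !mulNr !mul0r mul1r; lra.
have K0 : 0 <= 4 * b / w ^+ 2 by rewrite divr_ge0 ?sqr_ge0// mulr_ge0// ltW.
have := ler_wpM2l K0 gle.
by move: FE; lra.
Qed.

End gauss_itv.

(** * The cat state *)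

(** The parallelogram identity separates x from z, so that the Wigner integral becomes a Fourier
    transform of a Gaussian in z alone. *)
Lemma gauss_mul_midpoint (R : realType) (m n x z : R) :
  gauss pi m (x + z / 2) * gauss pi n (x - z / 2) =
  gauss (2 * pi) ((m + n) / 2) x * gauss (pi / 2) (m - n) z.
Proof. by rewrite /gauss -!expRD; congr expR; field. Qed.

(** Real and imaginary parts of exp(-pi (x - T)^2) exp(2 pi i T x) + e exp(-pi (x + T)^2) exp(-2 pi
    i T x), the superposition of the coherent states at (T, T) and (-T, -T). *)
Definition cat_state (R : realType) (T e x : R) : R[i] :=
  (gauss pi T x + e * gauss pi (- T) x) * cos (2 * pi * T * x) +i*
  ((gauss pi T x - e * gauss pi (- T) x) * sin (2 * pi * T * x)).

Lemma halfDD (R : realType) (x : R) : (x + x) / 2 = x.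
Proof. by field. Qed.

Section cat_state.
Variables (R : realType) (T e : R).
Implicit Types x z xi : R.
Notation mu := (@lebesgue_measure R).
Notation g m := (gauss (2 * pi) m : R -> R).
Notation h m := (gauss (pi / 2) m : R -> R).
Notation u := (cat_state T e).

Let pi2_gt0 : 0 < 2 * pi :> R. Proof. by rewrite mulr_gt0// pi_gt0. Qed.
Let pih_gt0 : 0 < pi / 2 :> R. Proof. by rewrite divr_gt0// pi_gt0. Qed.
Let pi_neq0 : pi != 0 :> R. Proof. by rewrite gt_eqF// pi_gt0. Qed.

Lemma schwartz_cat_state : schwartz u.
Proof.
apply: (@schwartz_gauss_trig _ pi (2 * pi * T) _ T (- T) T (- T)
  1%:P 0 e%:P 0 0 1%:P 0 (- e)%:P); first exact: pi_gt0.
- apply/funext => x; rewrite /cat_state /gauss_trig/= !(hornerC, horner0).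
  by ring.
- apply/funext => x; rewrite /cat_state /gauss_trig/= !(hornerC, horner0).
  by ring.
Qed.

(** The cross term carries the overlap of the two Gaussians, which is the tiny constant [g 0 T]
    times a Gaussian at 0. The phase [+ 0] matches the form of [Rintegral_gauss_cos]. *)
Lemma normc_cat_state x : Normc.normc (u x) ^+ 2 =
  g T x + e ^+ 2 * g (- T) x +
  2 * e * g 0 T * (g 0 x * cos (4 * pi * T * x + 0)).
Proof.
rewrite /= sqr_sqrtr ?addr_ge0 ?sqr_ge0// addr0.
have -> : 4 * pi * T * x = 2 * pi * T * x + 2 * pi * T * x by ring.
have EA m : g m x = gauss pi m x * gauss pi m x.
  by rewrite /gauss -expRD; congr expR; ring.
have EB : g 0 T * g 0 x = gauss pi T x * gauss pi (- T) x.
  by rewrite /gauss -!expRD; congr expR; ring.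
rewrite cosD (EA T) (EA (- T)).
transitivity (gauss pi T x * gauss pi T x + e ^+ 2 * (gauss pi (- T) x * gauss
  pi (- T) x) +
  2 * e * (g 0 T * g 0 x) * (cos (2 * pi * T * x) * cos (2 * pi * T * x) - sin
    (2 * pi * T * x) * sin (2 * pi * T * x))).
  rewrite EB; have := cos2Dsin2 (2 * pi * T * x); set c := cos _; set s :=
    sin _ => cs.
  have -> : s * s = 1 - c ^+ 2 by rewrite -cs; ring.
  have s2 : s ^+ 2 = 1 - c ^+ 2 by rewrite -cs; ring.
  rewrite !exprMn s2; ring.
ring.
Qed.

Lemma L2norm_cat_state_le : 0 <= e ->
  L2norm u ^+ 2 <= Num.sqrt (pi / (2 * pi)) * (1 + e ^+ 2 + 2 * e * g 0 T).
Proof.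
move=> e0.
have i1 m : mu.-integrable setT (EFin \o g m) by exact: integrable_gauss.
have i2 := integrable_gauss_cos pi2_gt0 0 (4 * pi * T) 0.
have i3 : mu.-integrable setT (EFin \o (fun x => g T x + e ^+ 2 * g (- T) x)).
  by apply: integrable_EFinD => //; exact: integrable_EFinZl.
have i4 : mu.-integrable setT
    (EFin \o (fun x => 2 * e * g 0 T * (g 0 x * cos (4 * pi * T * x + 0)))).
  exact: integrable_EFinZl.
have nE : (fun x => Normc.normc (u x) ^+ 2) = (fun x => g T x +
  e ^+ 2 * g (- T) x +
    2 * e * g 0 T * (g 0 x * cos (4 * pi * T * x + 0))).
  by apply/funext => x; exact: normc_cat_state.
rewrite L2norm_sqr ?nE; last exact: integrable_EFinD.
rewrite RintegralD// RintegralD//; last exact: integrable_EFinZl.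
rewrite !RintegralZl// !Rintegral_gauss// Rintegral_gauss_cos//.
rewrite mulr0 addr0 cos0 mulr1.
set c := Num.sqrt _.
have -> : c * (1 + e ^+ 2 + 2 * e * g 0 T) = c + e ^+ 2 * c +
  2 * e * g 0 T * c by ring.
rewrite lerD2l ler_wpM2l ?mulr_ge0 ?(ltW (gauss_gt0 _ _ _))//.
(* The Fourier factor of the cross term is simply bounded by 1, since [g 0 T] is already small
   enough. *)
rewrite ler_piMr ?sqrtr_ge0// -[leRHS]expR0 ler_expR oppr_le0.
by rewrite divr_ge0 ?sqr_ge0// mulr_ge0// ltW.
Qed.

(** Expansion of the Wigner integrand into two diagonal and two cross terms: p is the Fourier phase,
    t and t' are the phases of the state at x + z/2 and x - z/2. *)
Lemma cat_state_prod (A B A' B' p t t' : R) :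
  cexpi (- p) * ((A + B) * cos t +i* ((A - B) * sin t)) *
    ((A' + B') * cos t' +i* ((A' - B') * sin t'))^* =
  (A * A' * cos (t - t' - p) + B * B' * cos (t - t' + p) +
   A * B' * cos (t + t' - p) + B * A' * cos (t + t' + p)) +i*
  (A * A' * sin (t - t' - p) - B * B' * sin (t - t' + p) +
   A * B' * sin (t + t' - p) - B * A' * sin (t + t' + p)).
Proof.
rewrite /cexpi cosN sinN !(cosD, sinD, cosN, sinN).
by apply/eqP; rewrite eq_complex /=; apply/andP; split; apply/eqP; ring.
Qed.

Let sin_cos x : sin x = cos (x - pi / 2).
Proof. by rewrite -[LHS]cosBpihalf. Qed.

Lemma wigner_cat_state x xi : wigner u u x xi =
  (Num.sqrt (pi / (pi / 2)) *
   (g T x * g T xi + e ^+ 2 * (g (- T) x * g (- T) xi) +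
    2 * e * (g 0 x * g 0 xi * cos (4 * pi * T * (x - xi)))))%:C.
Proof.
(* One family covers both parts of the integrand: k = 0 gives the real part and k = - pi/2 the
   imaginary part, as cos(y - pi/2) = sin y. The terms with - k are those whose sine enters with a
   minus sign. *)
pose F (k : R) z :=
  g T x * (h 0 z * cos (2 * pi * (T - xi) * z + k)) +
  e ^+ 2 * g (- T) x * (h 0 z * cos (2 * pi * (T + xi) * z - k)) +
  (e * g 0 x * (h (T + T) z * cos (- (2 * pi * xi) * z + (4 * pi * T * x +
    k))) +
   e * g 0 x * (h (- (T + T)) z * cos (2 * pi * xi * z +
     (4 * pi * T * x - k)))).
have IF k : \int[mu]_z F k z = Num.sqrt (pi / (pi / 2)) *
   (g T x * g T xi * cos k + e ^+ 2 * (g (- T) x * g (- T) xi) * cos k +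
    e * (g 0 x * g 0 xi * (cos (4 * pi * T * (x - xi) + k) +
      cos (4 * pi * T * (x - xi) - k)))).
  have I m w t : mu.-integrable setT (EFin \o (fun z => h m z * cos (w * z +
    t))).
    exact: integrable_gauss_cos.
  have IZ c m w t : mu.-integrable setT (EFin \o (fun z =>
    c * (h m z * cos (w * z + t)))).
    exact: integrable_EFinZl.
  rewrite /F RintegralD//; try exact: integrable_EFinD.
  rewrite !RintegralD// !RintegralZl// !Rintegral_gauss_cos//.
  have E (v : R) : expR (- ((2 * pi * v) ^+ 2 / (4 * (pi / 2)))) = g 0 v.
    by rewrite /gauss; congr expR; move: pi pi_neq0 => P P0; field.
  have Em (v : R) : expR (- ((- (2 * pi * v)) ^+ 2 / (4 * (pi / 2)))) = g 0 v.
    by rewrite sqrrN E.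
  rewrite !E Em.
  have -> : g 0 (T - xi) = g T xi by rewrite /gauss; congr expR; ring.
  have -> : g 0 (T + xi) = g (- T) xi by rewrite /gauss; congr expR; ring.
  rewrite !mulr0 !add0r cosN.
  have -> : - (2 * pi * xi) * (T + T) + (4 * pi * T * x + k) =
    4 * pi * T * (x - xi) + k by ring.
  have -> : 2 * pi * xi * - (T + T) + (4 * pi * T * x - k) =
    4 * pi * T * (x - xi) - k by ring.
  ring.
have FE z : cexpi (- (2 * pi * z * xi)) * u (x + z / 2) * (u (x - z / 2))^* =
    F 0 z +i* F (- (pi / 2)) z.
  rewrite /cat_state cat_state_prod.
  have E1 : gauss pi T (x + z / 2) * gauss pi T (x - z / 2) = g T x * h 0 z.
    by rewrite gauss_mul_midpoint subrr halfDD.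
  have E2 : gauss pi (- T) (x + z / 2) * gauss pi (- T) (x - z / 2) =
    g (- T) x * h 0 z.
    by rewrite gauss_mul_midpoint subrr halfDD.
  have E3 : gauss pi T (x + z / 2) * gauss pi (- T) (x - z / 2) =
    g 0 x * h (T + T) z.
    by rewrite gauss_mul_midpoint subrr mul0r opprK.
  have E4 : gauss pi (- T) (x + z / 2) * gauss pi T (x - z / 2) =
    g 0 x * h (- (T + T)) z.
    by rewrite gauss_mul_midpoint addNr mul0r -opprD.
  have S1 : e * gauss pi (- T) (x + z / 2) * (e * gauss pi (- T) (x - z / 2)) =
      e ^+ 2 * (g (- T) x * h 0 z) by rewrite -E2; ring.
  have S2 : gauss pi T (x + z / 2) * (e * gauss pi (- T) (x - z / 2)) =
      e * (g 0 x * h (T + T) z) by rewrite -E3; ring.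
  have S3 : e * gauss pi (- T) (x + z / 2) * gauss pi T (x - z / 2) =
      e * (g 0 x * h (- (T + T)) z) by rewrite -E4; ring.
  rewrite E1 S1 S2 S3.
  set t := 2 * pi * T * (x + z / 2); set t' := 2 * pi * T * (x - z / 2).
  set p := 2 * pi * z * xi.
  have -> : t - t' - p = 2 * pi * (T - xi) * z by rewrite /t /t' /p;
    move: pi => P; field.
  have -> : t - t' + p = 2 * pi * (T + xi) * z by rewrite /t /t' /p;
    move: pi => P; field.
  have -> : t + t' - p = - (2 * pi * xi) * z + 4 * pi * T * x.
    by rewrite /t /t' /p; move: pi => P; field.
  have -> : t + t' + p = 2 * pi * xi * z + 4 * pi * T * x.
    by rewrite /t /t' /p; move: pi => P; field.
  rewrite /F !oppr0 !addr0 opprK; congr (_ +i* _); first ring.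
  have sN (y : R) : cos (y + pi / 2) = - sin y by rewrite cosDpihalf.
  by rewrite !addrA !sN -!sin_cos; ring.
rewrite /wigner /cintegral.
under eq_Rintegral do rewrite FE.
under [X in _ +i* X]eq_Rintegral do rewrite FE.
rewrite /= !IF; congr (_ +i* _).
  by rewrite !oppr0 !addr0 cos0; ring.
(* At k = - pi/2 the diagonal terms contain cos k = 0 and the two cross terms cancel, so the Wigner
   distribution is real. *)
by rewrite cosN cos_pihalf opprK -sin_cos cosDpihalf; ring.
Qed.

(** The addition formula for cos(4 pi T (x - xi)) writes the interference term as a sum of two
    tensor squares, so its integral over the square is a sum of squares and cannot be negative when
    e >= 0. *)
Lemma Rintegral_wigner_cat_state (a : R) :
  let J m := \int[mu]_(x in `[0, a]) g m x in
  let C := \int[mu]_(x in `[0, a]) (g 0 x * cos (4 * pi * T * x)) in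
  let S := \int[mu]_(x in `[0, a]) (g 0 x * sin (4 * pi * T * x)) in
  cintegral (mu \x mu)%E (`[0, a] `*` `[0, a])
    (fun p : R * R => wigner u u p.1 p.2) =
  (Num.sqrt (pi / (pi / 2)) *
   (J T ^+ 2 + e ^+ 2 * J (- T) ^+ 2 + 2 * e * (C ^+ 2 + S ^+ 2)))%:C.
Proof.
move=> J C S.
pose gc x := g 0 x * cos (4 * pi * T * x).
pose gs x := g 0 x * sin (4 * pi * T * x).
have ig m : mu.-integrable `[0, a] (EFin \o g m).
  by apply: continuous_integrable_itv; exact: continuous_gauss.
have ic : mu.-integrable `[0, a] (EFin \o gc).
  apply: continuous_integrable_itv.
  have -> : gc = (fun x => g 0 x * cos (4 * pi * T * x + 0)).
    by apply/funext => x; rewrite addr0.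
  exact: continuous_gauss_cos.
have is_ : mu.-integrable `[0, a] (EFin \o gs).
  by apply: continuous_integrable_itv; exact: continuous_gauss_sin.
pose Q : set (R * R) := `[0, a] `*` `[0, a].
have mQ : measurable Q by apply: measurableX; exact: measurable_itv.
pose tens (f1 : R -> R) (p : R * R) := f1 p.1 * f1 p.2.
have it f1 : mu.-integrable `[0, a] (EFin \o f1) ->
    (mu \x mu)%E.-integrable Q (EFin \o tens f1).
  by move=> i1; apply: integrable_prod => //; exact: measurable_itv.
have It f1 : mu.-integrable `[0, a] (EFin \o f1) ->
    \int[(mu \x mu)%E]_(p in Q) tens f1 p = (\int[mu]_(x in `[0, a]) f1 x) ^+ 2.
  by move=> i1; rewrite /tens Rintegral_prod//; exact: measurable_itv.
rewrite /cintegral -/Q; congr (_ +i* _); last first.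
  under eq_Rintegral do rewrite wigner_cat_state/=.
  by rewrite Rintegral_cst// mul0r.
under eq_Rintegral => p _.
  rewrite wigner_cat_state/=.
  have -> : Num.sqrt (pi / (pi / 2)) *
   (g T p.1 * g T p.2 + e ^+ 2 * (g (- T) p.1 * g (- T) p.2) +
    2 * e * (g 0 p.1 * g 0 p.2 * cos (4 * pi * T * (p.1 - p.2)))) =
   Num.sqrt (pi / (pi / 2)) * (tens (g T) p + e ^+ 2 * tens (g (- T)) p +
    2 * e * (tens gc p + tens gs p)).
    by rewrite mulrBr cosB /tens /gc /gs; ring.
  over.
have i1 := it _ (ig T); have i2 := it _ (ig (- T)).
have i3 := it _ ic; have i4 := it _ is_.
have j2 : (mu \x mu)%E.-integrable Q (EFin \o (fun p =>
  e ^+ 2 * tens (g (- T)) p)).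
  exact: integrable_EFinZl.
have j12 : (mu \x mu)%E.-integrable Q (EFin \o (fun p => tens (g T) p +
  e ^+ 2 * tens (g (- T)) p)).
  exact: integrable_EFinD.
have j34 : (mu \x mu)%E.-integrable Q (EFin \o (fun p => tens gc p +
  tens gs p)).
  exact: integrable_EFinD.
have k34 : (mu \x mu)%E.-integrable Q (EFin \o (fun p => 2 * e * (tens gc p +
  tens gs p))).
  exact: integrable_EFinZl.
rewrite RintegralZl//; last exact: integrable_EFinD.
by rewrite RintegralD// RintegralD// !RintegralZl// RintegralD// !It.
Qed.

End cat_state.

(** * Numerical estimates and choice of parameters *)

(** The exponential exp(2 pi T^2) is the cube of exp(2 pi T^2 / 3), which is at least 1 + 2 pi T^2 /
    3 > T^2 because pi >= 2. *)
Lemma gauss_2pi_small (R : realType) (T : R) : 0 < T ->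
  gauss (2 * pi) 0 T < (T ^+ 6)^-1.
Proof.
move=> T0; rewrite /gauss subr0 expRN ltf_pV2 ?posrE ?exprn_gt0 ?expR_gt0//.
have -> : 2 * pi * T ^+ 2 = 3%:R * (2 * pi * T ^+ 2 / 3%:R) by field.
rewrite expRM_natl (exprM T 2 3) ltrXn2r// ?nnegrE ?sqr_ge0 ?expR_ge0//.
apply: (lt_le_trans _ (expR_ge1Dx _)).
have := pi_ge2 R; have := sqr_ge0 T; nra.
Qed.

(** For T >= 8 the two error terms are at most 1/8 and 1/4, so at least half of 1 / (4 pi T)
    remains, and pi <= 4 gives the constant 32. *)
Lemma Rintegral_gauss_sin_ge_inv (R : realType) (T : R) : 8 <= T ->
  (32 * T)^-1 <= \int[lebesgue_measure]_(x in `[0, T + T])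
    (gauss (2 * pi) 0 x * sin (4 * pi * T * x)).
Proof.
move=> T8; have T0 : 0 < T by lra.
have p0 : 0 < pi :> R by exact: pi_gt0.
have p4 : pi <= 4 :> R by have := pihalf_lt2 R; lra.
have b0 : 0 < 2 * pi :> R by rewrite mulr_gt0.
have w0 : 0 < 4 * pi * T by rewrite !mulr_gt0.
have TT0 : 0 < T + T by lra.
apply: (le_trans _ (Rintegral_gauss_sin_ge b0 TT0 w0)).
set c := Num.sqrt _; set d := gauss _ _ _.
have c1 : c <= 1.
  rewrite -[leRHS]sqrtr1 ler_wsqrtr// ler_pdivrMr// mul1r; lra.
have d1 : d <= 8^-1.
  rewrite (le_trans (ltW (gauss_2pi_small TT0)))// lef_pV2 ?posrE ?exprn_gt0//.
  by rewrite (le_trans _ (ler_eXnr _ _))//; lra.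
have -> : (1 - d) / (4 * pi * T) - 4 * (2 * pi) / (4 * pi * T) ^+ 2 * c =
    (1 - d - 2 * c / T) / (4 * pi * T).
  by move: (pi : R) p0 => P P0; field; rewrite !gt_eqF.
have h : 2 * c / T <= 4^-1 by rewrite ler_pdivrMr//; lra.
apply: (@le_trans _ _ (2^-1 / (4 * pi * T))).
  rewrite -invfM lef_pV2 ?posrE ?mulr_gt0//.
  by rewrite !mulrA ler_pM2r//; lra.
by rewrite ler_pM2r ?invr_gt0//; lra.
Qed.

(** Here e = 2q. After division by c, interference gains at least 4eq and the norm costs e^2; the
    choice e = 2q maximises 4eq - e^2, leaving 4q^2. The remaining loss is at most 4d + 4qd <= 8d <
    2q^2. *)
Lemma cat_state_gain (R : realType) (q d J c s r K S C : R) :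
  0 < q -> q <= 1 -> 0 <= d -> 4 * d < q ^+ 2 ->
  0 < c -> s = 2 * c -> s * c = 1 -> c * (1 - 2 * d) <= J -> q <= S ^+ 2 ->
  r <= c * (1 + (2 * q) ^+ 2 + 2 * (2 * q) * d) ->
  r < s * (J ^+ 2 + (2 * q) ^+ 2 * K ^+ 2 + 2 * (2 * q) * (C ^+ 2 + S ^+ 2)).
Proof.
move=> q0 q1 d0 dq c0 -> sc hJ hS hr; apply: (le_lt_trans hr).
have dq1 : 2 * d <= 1 by nra.
have hJ2 : (c * (1 - 2 * d)) ^+ 2 <= J ^+ 2.
  by rewrite lerXn2r// nnegrE; [nra|apply: le_trans hJ; nra].
apply: (@lt_le_trans _ _ (2 * c * ((c * (1 - 2 * d)) ^+ 2 + 4 * q * q))).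
  have -> : 2 * c * ((c * (1 - 2 * d)) ^+ 2 + 4 * q * q) =
     c * (2 * c * c * (1 - 2 * d) ^+ 2 + 8 * q ^+ 2) by ring.
  rewrite sc mul1r ltr_pM2l//.
  have h1 := sqr_ge0 d.
  have h2 : 4 * q * d <= 4 * d by nra.
  have -> : (1 - 2 * d) ^+ 2 = 1 - 4 * d + 4 * d ^+ 2 by ring.
  have -> : (2 * q) ^+ 2 = 4 * q ^+ 2 by ring.
  by lra.
rewrite ler_wpM2l ?mulr_ge0 ?(ltW c0)//.
have hK : 0 <= (2 * q) ^+ 2 * K ^+ 2 by rewrite mulr_ge0 ?sqr_ge0.
have hC : 0 <= q * C ^+ 2 by rewrite mulr_ge0 ?sqr_ge0// ltW.
have hqS : q * q <= q * S ^+ 2 by rewrite ler_wpM2l// ltW.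
lra.
Qed.

(* The strict order of R[i] compares real parts of numbers with equal
   imaginary parts, so the inequality includes that the integral is real. *)
Theorem theorem1p2 (R : realType) :
  exists (a : R) (u : R -> R[i]),
    [/\ 0 < a, schwartz u &
        cintegral (lebesgue_measure \x lebesgue_measure)%E
          (`[0, a] `*` `[0, a])
          (fun p : R * R => wigner u u p.1 p.2)
        > (L2norm u ^+ 2)%:C].
Proof.
(* q is the square of the lower bound 1 / (32 T) for the sine integral. T = 2 n^2 makes q^2 =
   (nT)^-4 equal to 4 T^-6, exactly what 4d < q^2 needs given d < T^-6. *)
pose n : R := 32; pose T : R := 2 * n ^+ 2; pose q : R := (n * T)^-1 ^+ 2.
have n0 : 0 < n by [].
have n1 : 1 <= n by rewrite ler1n.
have T0 : 0 < T by rewrite mulr_gt0// exprn_gt0.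
have T8 : 8 <= T by rewrite /T /n; lra.
have q0 : 0 < q by rewrite exprn_gt0// invr_gt0 mulr_gt0.
have p0 : 0 < pi :> R by exact: pi_gt0.
have b0 : 0 < 2 * pi :> R by rewrite mulr_gt0.
exists (T + T), (cat_state T (2 * q)); split.
- by rewrite addr_gt0.
- exact: schwartz_cat_state.
rewrite Rintegral_wigner_cat_state ltcR.
set d := gauss (2 * pi) 0 T.
have d0 : 0 <= d by rewrite ltW// gauss_gt0.
set c : R := Num.sqrt (pi / (2 * pi)).
have c2 : c ^+ 2 = 2^-1.
  rewrite sqr_sqrtr ?divr_ge0 ?(ltW p0) ?(ltW b0)//.
  by move: (pi : R) p0 => P P0; field; rewrite gt_eqF.
have c0 : 0 < c by rewrite sqrtr_gt0 divr_gt0.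
have sE : Num.sqrt (pi / (pi / 2)) = 2 * c.
  have -> : pi / (pi / 2) = (2 * c) ^+ 2 :> R.
    by rewrite exprMn c2; move: (pi : R) p0 => P P0; field; rewrite gt_eqF.
  by rewrite sqrtr_sqr ger0_norm// mulr_ge0// ltW.
apply: (@cat_state_gain _ q d _ c) => //.
- rewrite /q exprVn invf_le1 ?exprn_gt0 ?mulr_gt0// exprn_ege1//.
  by rewrite mulr_ege1//; lra.
- have -> : q ^+ 2 = 4 * (T ^+ 6)^-1.
    (* The identity is proved for a variable m, so that no large powers of 32 are computed. *)
    have H (m : R) : 0 < m -> (m * (2 * m ^+ 2))^-1 ^+ 2 ^+ 2 =
        4 * ((2 * m ^+ 2) ^+ 6)^-1 by move=> m0; field; rewrite gt_eqF.
    exact: H.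
  by rewrite ltr_pM2l// gauss_2pi_small.
- by rewrite sE -mulrA -expr2 c2 divff.
- exact: (Rintegral_gauss_itv_ge b0 (ltW T0)).
- rewrite /q lerXn2r ?nnegrE ?invr_ge0 ?mulr_ge0 ?(ltW n0) ?(ltW T0)//.
    rewrite (le_trans _ (Rintegral_gauss_sin_ge_inv T8))//.
    by rewrite invr_ge0 mulr_ge0// ltW.
  exact: Rintegral_gauss_sin_ge_inv.
- by apply: L2norm_cat_state_le => //; rewrite mulr_ge0// ltW.
Qed.
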